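(* Consider the nonholonomic DAE $$\dot y=f(y)+\lambda_\alpha\begin{pmatrix}0\\ m^{-1}\nabla_v\varphi^\alpha(y)\end{pmatrix},\qquad \varphi^\alpha(y)=0\quad(\alpha=1,\dots,m),$$ for unknowns $y=(q,v)\in\mathbb{R}^{2n}$, $\lambda=(\lambda_1,\dots,\lambda_m)\in\mathbb{R}^m$, with $f$, $m^{-1}$, $\varphi^\alpha$, $D$ as in the context. This DAE induces the ODE $\dot x=h(x)$ on the submanifold $D\subset\mathbb{R}^{2n}$, where for $x=(q^i,v^i)\in D$ $$h(x):=f(x)+\lambda_\alpha(x)\begin{pmatrix}0\\ m^{-1}\nabla_v\varphi^\alpha(x)\end{pmatrix},$$ $$\lambda_\alpha(x)=-C_{\alpha\beta}(x)\left(\frac{\partial\mu^\beta_i(q)}{\partial q^j}v^iv^j+\mu^\beta_i(q)\,m^{ij}\frac{\partial L}{\partial q^j}-\mu^\beta_i(q)\,m^{ik}\frac{\partial^2L}{\partial q^j\partial v^k}v^j\right),$$ and $(C_{\alpha\beta})$ is the inverse of the matrix $(C^{\alpha\beta})=(\mu^\alpha_i m^{ij}\mu^\beta_j)$. That is, $h(x)\in T_xD$ for every $x\in D$, and a curve $(y(t),\lambda(t))$ solves the DAE if and only if $y(t)\in D$ for all $t$, $\dot y(t)=h(y(t))$ and $\lambda_\alpha(t)=\lambda_\alpha(y(t))$.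
   Context: Repeated indices are summed. The configuration space is $Q=\mathbb{R}^n$ with coordinates $q^i$, and $TQ\simeq\mathbb{R}^{2n}$ has coordinates $(q^i,v^i)$, $i=1,\dots,n$. All data are smooth. $L:TQ\to\mathbb{R}$ is a Lagrangian such that the matrix $(m_{ij})=\left(\frac{\partial^2L}{\partial v^i\partial v^j}\right)$ depends only on $q$ and is regular and positive definite; $(m^{ij})=m^{-1}$ is its inverse. The constraints are given by one-forms $\mu^\alpha=\mu^\alpha_i(q)\,dq^i$, $\alpha=1,\dots,m$ ($m\le n$), linearly independent at every $q$. (The letter $m$ is used both for the number of constraints and for the metric matrix.) Set $\varphi^\alpha(q,v)=\mu^\alpha_i(q)v^i$ and $D=\{(q,v)\in\mathbb{R}^{2n}:\varphi^\alpha(q,v)=0,\ \alpha=1,\dots,m\}$, a submanifold of dimension $2n-m$. $\nabla_v\varphi^\alpha=(\partial\varphi^\alpha/\partial v^j)_j=(\mu^\alpha_j)_j$ and $m^{-1}\nabla_v\varphi^\alpha$ is the vector with components $m^{ij}\mu^\alpha_j$. The map $f:\mathbb{R}^{2n}\to\mathbb{R}^{2n}$ is $$f(q,v)=\left(v^i,\ -m^{ik}\frac{\partial^2L}{\partial q^j\partial v^k}v^j+m^{ij}\frac{\partial L}{\partial q^j}\right)^T.$$ The matrix $(C^{\alpha\beta})$ is invertible under these assumptions. *)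

(* Defs.v *)
From HB Require Import structures.
From mathcomp Require Export all_boot all_order all_algebra.
From mathcomp Require Export all_classical all_reals all_analysis.

Set Implicit Arguments.
Unset Strict Implicit.
Unset Printing Implicit Defensive.

Export Order.TTheory GRing.Theory Num.Theory numFieldNormedType.Exports.

Local Open Scope classical_set_scope.
Local Open Scope ring_scope.

(* [Ck_on A k f] and [smooth_on A f] are meant for open [A] and a
   finite-dimensional [V], where they are the usual classes C^k(A) and
   C^infinity(A); for open [A], ['D_v f] on [A] only depends on [f] on [A]. *)
Fixpoint Ck_on (R : realType) (V W : normedModType R) (A : set V) (k : nat)
    (f : V -> W) : Prop :=
  match k with
  | 0 => forall x, A x -> {for x, continuous f}
  | k'.+1 => (forall x, A x -> differentiable f x) /\
             (forall v : V, Ck_on A k' ('D_v f))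
  end.

Definition smooth_on (R : realType) (V W : normedModType R) (A : set V)
  (f : V -> W) : Prop := forall k, Ck_on A k f.

Definition smooth (R : realType) (V W : normedModType R) (f : V -> W) : Prop :=
  smooth_on [set: V] f.

(* [tangent S x w]: w is the velocity at x of a smooth curve in S. *)
Definition tangent (R : realType) (V : normedModType R) (S : set V) (x w : V) :
    Prop :=
  exists (e : R) (c : R^o -> V),
    [/\ 0 < e,
        smooth_on [set t : R^o | `|t| < e] c,
        (forall t : R, `|t| < e -> S (c t)),
        c 0 = x
      & is_derive (0 : R^o) 1 c w].

(* No symmetry is required: the matrices this is applied to are Hessians. *)
Definition posdefmx (R : realType) (n : nat) (A : 'M[R]_n) : Prop :=
  forall u : 'cV[R]_n, u != 0 -> 0 < (u^T *m A *m u) 0 0.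

(* The configuration space Q = R^n and its tangent bundle, points being
   y = (q, v) with q = y.1 and v = y.2. *)
Notation Qsp R n := ('cV[R]_n) (only parsing).
Notation TQ R n := ('cV[R]_n * 'cV[R]_n)%type (only parsing).

Section Nonholonomic.
Variables (R : realType) (n m : nat).

Definition dq (i : 'I_n) (g : TQ R n -> R^o) : TQ R n -> R^o :=
  'D_((delta_mx i 0, 0) : TQ R n) g.

Definition dv (i : 'I_n) (g : TQ R n -> R^o) : TQ R n -> R^o :=
  'D_((0, delta_mx i 0) : TQ R n) g.

Definition gradv (g : TQ R n -> R^o) (x : TQ R n) : 'cV[R]_n :=
  \col_j dv j g x.

Variable L : TQ R n -> R^o.

(* (m_ij) and (m^ij) are written as functions on TQ; that they depend only on
   q is a hypothesis on L. *)
Definition mass (x : TQ R n) : 'M[R]_n := \matrix_(i, j) dv i (dv j L) x.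

Definition minv (x : TQ R n) : 'M[R]_n := invmx (mass x).

Definition f (x : TQ R n) : TQ R n :=
  (x.2,
   \col_i (- (\sum_j \sum_k minv x i k * dq j (dv k L) x * x.2 j 0)
           + \sum_j minv x i j * dq j L x)).

(* The one-forms mu^a are the rows of mu : mu q a i is mu^a_i(q). *)
Variable mu : Qsp R n -> 'M[R]_(m, n).

Definition phi (a : 'I_m) (x : TQ R n) : R^o := \sum_i mu x.1 a i * x.2 i 0.

Definition D : set (TQ R n) := [set x | forall a, phi a x = 0].

Definition dmu (j : 'I_n) (b : 'I_m) (i : 'I_n) (q : Qsp R n) : R :=
  'D_(delta_mx j 0 : Qsp R n) (fun p : Qsp R n => mu p b i : R^o) q.

Definition Cmx (x : TQ R n) : 'M[R]_m :=
  \matrix_(a, b) \sum_i \sum_j mu x.1 a i * minv x i j * mu x.1 b j.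

Definition lambda (x : TQ R n) : 'cV[R]_m :=
  \col_a (- (\sum_b invmx (Cmx x) a b *
    (\sum_i \sum_j dmu j b i x.1 * x.2 i 0 * x.2 j 0
     + \sum_i \sum_j mu x.1 b i * minv x i j * dq j L x
     - \sum_i \sum_j \sum_k mu x.1 b i * minv x i k * dq j (dv k L) x * x.2 j 0))).

Definition constrained_field (l : 'cV[R]_m) (x : TQ R n) : TQ R n :=
  f x + \sum_a l a 0 *: ((0, minv x *m gradv (phi a) x) : TQ R n).

Definition h (x : TQ R n) : TQ R n := constrained_field (lambda x) x.

(* No regularity beyond differentiability of y is part of being a solution. *)
Definition DAE_solution (I : set R) (y : R^o -> TQ R n) (l : R -> 'cV[R]_m) :
    Prop :=
  forall t : R, I t ->
    is_derive (t : R^o) 1 y (constrained_field (l t) (y t)) /\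
    (forall a, phi a (y t) = 0).

End Nonholonomic.

(* Main.v *)
Require Import Defs.
From mathcomp Require Import perm.

(* Differentiating [phi^a = 0] along a solution gives the linear system
   [drift + C lambda = 0], where [C = mu m^-1 mu^T] is invertible because m^-1
   is positive definite and mu has full rank; this determines lambda.
   Conversely this system says that the differentials of the [phi^a] at [x]
   vanish on [h x], and such a vector [w] is the velocity of the curve obtained
   by retracting the line [x + t w'] onto [D], [w'] being [w] corrected by a
   multiple of [(0, v)].  With [B = m^-1 mu^T] frozen at [x] and
   [G q = mu q B], the retraction
   [(q, v) |-> (q, (det (G q) v - B adj (G q) mu q v) / det C)] is defined and
   smooth on all of TQ, without inverting [G], and has values in [D], since
   [G q adj (G q) = det (G q)]. *)

Set Implicit Arguments.
Unset Strict Implicit.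
Unset Printing Implicit Defensive.

Local Open Scope classical_set_scope.
Local Open Scope ring_scope.

(** * Chain rules, and differentials of linear and affine maps *)

Lemma derive_comp (R : realType) (U V W : normedModType R) (f : U -> V)
    (g : V -> W) (x v : U) :
  differentiable f x -> differentiable g (f x) ->
  'D_v (g \o f) x = 'D_('D_v f x) g (f x).
Proof.
move=> df dg; rewrite (deriveE v df) (deriveE _ dg).
by rewrite (deriveE v (differentiable_comp df dg)) (diff_comp df dg).
Qed.

Lemma derive_is_diff (R : realType) (V W : normedModType R) (f df : V -> W)
    (x v : V) : is_diff x f df -> 'D_v f x = df v.
Proof. by case=> fx <-; exact: deriveE. Qed.

Lemma is_diff_fst (R : realType) (V W : normedModType R) (x : V * W) :
  is_diff x fst fst.
Proof.
have fst_cont : continuous (fst : V * W -> V) by move=> ?; exact: cvg_fst.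
apply: DiffDef; first exact/linear_differentiable.
by rewrite diff_lin.
Qed.

Lemma is_diff_snd (R : realType) (V W : normedModType R) (x : V * W) :
  is_diff x snd snd.
Proof.
have snd_cont : continuous (snd : V * W -> W) by move=> ?; exact: cvg_snd.
apply: DiffDef; first exact/linear_differentiable.
by rewrite diff_lin.
Qed.

Lemma is_diff_coord (R : realType) (m n : nat) (i : 'I_m) (j : 'I_n)
    (M : 'M[R]_(m, n)) :
  is_diff M (fun N : 'M[R]_(m, n) => N i j : R^o) (fun N => N i j).
Proof.
apply: DiffDef; first exact: differentiable_coord.
apply/funext => N; rewrite -deriveE; last exact: differentiable_coord.
(* The differential of a coordinate is read off, entry by entry, from the derivative of the
   identity. *)
have dM : derivable (id : 'M[R]_(m, n) -> _) M N by exact: derivable_id.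
by have := derive_mx dM; rewrite derive_id => /matrixP/(_ i j); rewrite mxE.
Qed.

(** Stated at a single time, so that it applies to a solution of the DAE, which is merely
    differentiable. *)
Lemma is_derive_comp1 (R : realType) (V W : normedModType R) (c : R^o -> V)
    (g : V -> W) (t : R^o) (w : V) :
  is_derive t 1 c w -> differentiable g (c t) ->
  is_derive t 1 (g \o c) ('D_w g (c t)).
Proof.
move=> [/derivable1_diffP dc <-] dg; split.
  exact/derivable1_diffP/differentiable_comp.
exact: derive_comp.
Qed.

Lemma is_diff_line (R : realType) (V : normedModType R) (x w : V) (t : R^o) :
  is_diff t (fun s : R^o => x + s *: w) (fun s : R^o => s *: w).
Proof.
have := is_diffD (is_diff_cst x t) (is_diff_scalel t w).
rewrite (_ : (_ + _ : R^o -> V) = fun s : R^o => x + s *: w) //.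
by rewrite add0r.
Qed.

(** * Closure properties of smooth maps *)

Section Smooth.
Variable R : realType.
Implicit Types U V W : normedModType R.

Lemma Ck_sub V W (A B : set V) k (f : V -> W) :
  A `<=` B -> Ck_on B k f -> Ck_on A k f.
Proof.
move=> AB; elim: k f => [|k IHk] f /=; first by move=> fB x /AB; exact: fB.
by case=> fB dfB; split=> [x /AB|v]; [exact: fB | exact: IHk].
Qed.

(** The Leibniz rule in [CkM] needs this: it keeps the undifferentiated factors, which must be
    lowered to class C^k before the induction hypothesis applies. *)
Lemma CkS V W (A : set V) k (f : V -> W) : Ck_on A k.+1 f -> Ck_on A k f.
Proof.
elim: k f => [|k IHk] f.
  by case=> df _ x Ax; apply/differentiable_continuous/df.
by case=> df d2f; split=> // v; exact/IHk/d2f.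
Qed.

Lemma smooth_differentiable V W (f : V -> W) x : smooth f -> differentiable f x.
Proof. by move=> /(_ 1%N)[+ _]; apply. Qed.

Lemma smooth_derivable V W (f : V -> W) x v : smooth f -> derivable f x v.
Proof. by move=> fs; exact/diff_derivable/smooth_differentiable. Qed.

Lemma smooth_cst V W (c : W) : smooth (cst c : V -> W).
Proof.
move=> k; elim: k c => [|k IHk] c; first by move=> x _; exact: cst_continuous.
split=> [x _|v]; first exact: differentiable_cst.
rewrite (_ : 'D_v (cst c) = cst 0); first exact: IHk.
by apply/funext => x; rewrite derive_cst.
Qed.

Lemma CkD V W k (f g : V -> W) :
  Ck_on setT k f -> Ck_on setT k g -> Ck_on setT k (f + g).
Proof.
elim: k f g => [|k IHk] f g.
  by move=> fc gc x _; apply: continuousD; [exact: fc | exact: gc].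
move=> [df d2f] [dg d2g]; split=> [x _|v].
  by apply: differentiableD; [exact: df | exact: dg].
rewrite (_ : 'D_v (f + g) = 'D_v f + 'D_v g).
  by apply: IHk; [exact: d2f | exact: d2g].
apply/funext => x.
by rewrite deriveD //; apply: diff_derivable; solve [exact: df | exact: dg].
Qed.

Lemma CkM V k (f g : V -> R^o) :
  Ck_on setT k f -> Ck_on setT k g -> Ck_on setT k (f * g).
Proof.
elim: k f g => [|k IHk] f g.
  by move=> fc gc x _; apply: continuousM; [exact: fc | exact: gc].
move=> Cf Cg; case: (Cf) (Cg) => df d2f [dg d2g]; split=> [x _|v].
  by apply: differentiableM; [exact: df | exact: dg].
rewrite (_ : 'D_v (f * g) = f * 'D_v g + g * 'D_v f).
  have [C1 C2] := (CkS Cf, CkS Cg).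
  by apply: CkD; [apply: IHk C1 (d2g v) | apply: IHk C2 (d2f v)].
apply/funext => x.
by rewrite deriveM //; apply: diff_derivable; solve [exact: df | exact: dg].
Qed.

Lemma smoothD V W (f g : V -> W) : smooth f -> smooth g -> smooth (f + g).
Proof. by move=> fs gs k; exact: CkD. Qed.

Lemma smoothM V (f g : V -> R^o) : smooth f -> smooth g -> smooth (f * g).
Proof. by move=> fs gs k; exact: CkM. Qed.

(** The hypothesis makes [l] its own differential at every point, so ['D_v (l \o f)] is
    [l \o 'D_v f]. This has the same shape as [l \o f], and the induction on the order closes. *)
Lemma smooth_lin_comp U V W (f : U -> V) (l : V -> W) :
  (forall y, is_diff y l l) -> smooth f -> smooth (l \o f).
Proof.
move=> dl fs k; move: (fs k) => {fs}.
have diffl y : differentiable l y by have [] := dl y.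
elim: k f => [|k IHk] f.
  move=> fc x _; apply: continuous_comp; first exact: fc.
  exact/differentiable_continuous.
move=> [df d2f]; split=> [x _|v].
  by apply: differentiable_comp => //; exact: df.
rewrite (_ : 'D_v (l \o f) = l \o 'D_v f); first exact/IHk/d2f.
apply/funext => x; rewrite derive_comp //; last exact: df.
exact: derive_is_diff.
Qed.

(** Since the differential [l] of [a] is the same at all points, ['D_v (f \o a)] is
    ['D_(l v) f \o a], again a composite with [a]. *)
Lemma smooth_comp_affine U V W (f : V -> W) (a l : U -> V) :
  (forall x, is_diff x a l) -> smooth f -> smooth (f \o a).
Proof.
move=> da fs k; move: (fs k) => {fs}.
have diffa x : differentiable a x by have [] := da x.
elim: k f => [|k IHk] f.
  move=> fc x _; apply: continuous_comp; last exact: fc.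
  exact/differentiable_continuous.
move=> [df d2f]; split=> [x _|v].
  by apply: differentiable_comp => //; exact: df.
rewrite (_ : 'D_v (f \o a) = 'D_(l v) f \o a); first exact/IHk/d2f.
apply/funext => x; rewrite derive_comp //; last exact: df.
by rewrite (derive_is_diff v (da x)).
Qed.

Lemma smooth_lin V W (l : V -> W) : (forall x, is_diff x l l) -> smooth l.
Proof.
move=> dl [|k].
  by move=> x _; apply/differentiable_continuous; have [] := dl x.
split=> [x _|v]; first by have [] := dl x.
rewrite (_ : 'D_v l = cst (l v)); first exact: smooth_cst.
by apply/funext => x; exact: derive_is_diff.
Qed.

Lemma smooth_sum V W (I : Type) (r : seq I) (F : I -> V -> W) :
  (forall i, smooth (F i)) -> smooth (\sum_(i <- r) F i).
Proof.
move=> Fs; elim/big_ind: _ => // [|f g]; [exact: smooth_cst | exact: smoothD].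
Qed.

Lemma smooth_prod V (I : Type) (r : seq I) (F : I -> V -> R^o) :
  (forall i, smooth (F i)) -> smooth (\prod_(i <- r) F i).
Proof.
move=> Fs; elim/big_ind: _ => // [|f g]; [exact: smooth_cst | exact: smoothM].
Qed.

Lemma derive_fst V W U (g : V -> U) (x w : V * W) :
  differentiable g x.1 -> 'D_w (fun z : V * W => g z.1) x = 'D_(w.1) g x.1.
Proof.
move=> dg; have [dfst _] := is_diff_fst x.
by have := derive_comp w dfst dg; rewrite (derive_is_diff w (is_diff_fst x)).
Qed.

Lemma smooth_fst V W U (g : V -> U) :
  smooth g -> smooth (fun z : V * W => g z.1).
Proof. exact: (smooth_comp_affine (@is_diff_fst _ _ _)). Qed.

Lemma smoothZ V W (c : R) (f : V -> W) : smooth f -> smooth (c *: f).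
Proof.
exact: (smooth_lin_comp (fun y => is_diff_scaler c y)).
Qed.

Lemma smoothZl V W (f : V -> R^o) (e : W) :
  smooth f -> smooth (fun x => f x *: e).
Proof.
have dl (r : R^o) : is_diff r (fun r : R^o => r *: e) (fun r : R^o => r *: e).
  exact: is_diff_scalel.
move=> fs; have := smooth_lin_comp dl fs; exact.
Qed.

Lemma derive_pair U V W (f : U -> V) (g : U -> W) (x v : U) :
  differentiable f x -> differentiable g x ->
  'D_v (fun y => (f y, g y)) x = ('D_v f x, 'D_v g x).
Proof.
move=> df dg; rewrite (deriveE _ (differentiable_pair df dg)) (diff_pair df dg).
by rewrite (deriveE _ df) (deriveE _ dg).
Qed.

Lemma smooth_pair U V W (f : U -> V) (g : U -> W) :
  smooth f -> smooth g -> smooth (fun y => (f y, g y)).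
Proof.
move=> fs gs k; move: (fs k) (gs k) => {fs gs}.
elim: k f g => [|k IHk] f g.
  move=> fc gc x _; apply: cvg_pair; [exact: fc | exact: gc].
move=> [df d2f] [dg d2g]; split=> [x _|v].
  by apply: differentiable_pair; [exact: df | exact: dg].
rewrite (_ : 'D_v _ = fun y => ('D_v f y, 'D_v g y)).
  by apply: IHk; [exact: d2f | exact: d2g].
by apply/funext => x; apply: derive_pair; [exact: df | exact: dg].
Qed.

(** Expanding in the elementary matrices gives a finite sum of smooth functions times constant
    matrices. *)
Lemma smooth_mx V m n (F : V -> 'M[R]_(m, n)) :
  (forall i j, smooth (fun x => F x i j : R^o)) -> smooth F.
Proof.
move=> Fs; rewrite (_ : F =
  \sum_i \sum_j (fun x => F x i j *: delta_mx i j)); last first.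
  apply/funext => x; rewrite {1}[F x]matrix_sum_delta fct_sumE.
  by apply: eq_bigr => i _; rewrite fct_sumE.
apply: smooth_sum => i; apply: smooth_sum => j.
exact: (smoothZl (delta_mx i j : 'M[R]_(m, n)) (Fs i j)).
Qed.

Lemma smooth_det V n (F : V -> 'M[R]_n) :
  (forall i j, smooth (fun x => F x i j : R^o)) ->
  smooth (fun x => \det (F x) : R^o).
Proof.
move=> Fs; rewrite (_ : (fun x => _) = \sum_(s : 'S_n)
    ((-1) ^+ s : R) *: \prod_i ((fun x => F x i (s i)) : V -> R^o)); last first.
  apply/funext => x; rewrite fct_sumE; apply: eq_bigr => s _.
  by rewrite fctE fct_prodE.
by apply: smooth_sum => s; apply: smoothZ; exact: smooth_prod.
Qed.

Lemma smooth_adj V n (F : V -> 'M[R]_n) :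
  (forall i j, smooth (fun x => F x i j : R^o)) ->
  forall i j, smooth (fun x => (\adj (F x)) i j : R^o).
Proof.
move=> Fs i j; rewrite (_ : (fun _ => _) = ((-1) ^+ (j + i) : R) *:
    (fun x => \det (row' j (col' i (F x))) : R^o)); last first.
  by apply/funext => x; rewrite mxE.
apply/smoothZ/smooth_det => k l.
rewrite (_ : (fun _ => _) = fun x => F x (lift j k) (lift i l) : R^o) //.
by apply/funext => x; rewrite !mxE.
Qed.

End Smooth.

(** * Positive definite matrices without symmetry *)

(** With u = A w, the form u^T A^-1 u is w^T A^T w, which as a 1 x 1 matrix is the transpose of w^T
    A w. *)
Lemma posdefmx_inv (R : realType) (n : nat) (A : 'M[R]_n) :
  A \in unitmx -> posdefmx A -> posdefmx (invmx A).
Proof.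
move=> Au Apos u u0; set w := invmx A *m u.
have uE : u = A *m w by rewrite mulKVmx.
have w0 : w != 0 by apply: contraNneq u0 => w0; rewrite uE w0 mulmx0.
have -> : u^T *m invmx A *m u = (w^T *m A *m w)^T.
  by rewrite -mulmxA -/w; clearbody w; rewrite uE !trmx_mul trmxK mulmxA.
by rewrite mxE; exact: Apos.
Qed.

(** If a row u kills M A M^T, then the form of A vanishes at (u M)^T; hence u M = 0, and u = 0
    because the rows of M are independent. *)
Lemma posdefmx_congr_unit (R : realType) (m n : nat) (A : 'M[R]_n)
    (M : 'M[R]_(m, n)) :
  posdefmx A -> row_free M -> M *m A *m M^T \in unitmx.
Proof.
move=> Apos Mfree; rewrite -row_free_unit -kermx_eq0.
apply/eqP/row_matrixP => i; rewrite row0; set u := row i _.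
have uC : u *m (M *m A *m M^T) = 0 by apply/sub_kermxP; exact: row_sub.
have [uM|uM] := eqVneq ((u *m M)^T) 0.
  by apply: (row_free_inj Mfree); rewrite mul0mx -[LHS]trmxK uM trmx0.
have := Apos _ uM; rewrite trmxK trmx_mul -!mulmxA.
by rewrite !mulmxA in uC *; rewrite uC mul0mx mxE ltxx.
Qed.

(** * The constraint functions and their derivatives along the constrained field *)

Section Constraints.
Variables (R : realType) (n m : nat).
Variables (mu : Qsp R n -> 'M[R]_(m, n)).
Hypothesis mu_smooth : smooth mu.

Lemma smooth_mu_entry a i : smooth (fun q => mu q a i : R^o).
Proof.
exact: (smooth_lin_comp (l := fun N : 'M[R]_(m, n) => N a i : R^o)
  (is_diff_coord a i)).
Qed.

Lemma phiE a : phi mu a = \sum_i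
  (fun z : TQ R n => mu z.1 a i : R^o) * (fun z : TQ R n => z.2 i 0 : R^o).
Proof. by apply/funext => x; rewrite fct_sumE. Qed.

Lemma smooth_coord2 i : smooth (fun z : TQ R n => z.2 i 0 : R^o).
Proof.
apply: (smooth_comp_affine (f := fun v : 'cV[R]_n => v i 0 : R^o)
  (@is_diff_snd _ _ _)).
exact/smooth_lin/is_diff_coord.
Qed.

Lemma smooth_mu1 a i : smooth (fun z : TQ R n => mu z.1 a i : R^o).
Proof.
exact: (smooth_comp_affine (f := fun q => mu q a i : R^o)
  (@is_diff_fst _ _ _) (smooth_mu_entry a i)).
Qed.

Lemma smooth_phi a : smooth (phi mu a).
Proof.
rewrite phiE; apply: smooth_sum => i.
by apply: smoothM; [exact: smooth_mu1 | exact: smooth_coord2].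
Qed.

Lemma derive_mu_entry a i q (p : 'cV[R]_n) :
  'D_p (fun q => mu q a i : R^o) q = \sum_j dmu mu j a i q * p j 0 :> R.
Proof.
have d := smooth_differentiable q (smooth_mu_entry a i).
rewrite (deriveE _ d) {1}[p]matrix_sum_delta linear_sum; apply: eq_bigr => j _.
by rewrite big_ord1 linearZ /= -(deriveE _ d) mulrC.
Qed.

Lemma derive_mu1 a i (x w : TQ R n) :
  'D_w (fun z : TQ R n => mu z.1 a i : R^o) x =
  \sum_j dmu mu j a i x.1 * w.1 j 0 :> R.
Proof.
rewrite (derive_fst _ (smooth_differentiable x.1 (smooth_mu_entry a i))).
exact: derive_mu_entry.
Qed.

Lemma derive_coord2 i (x w : TQ R n) :
  'D_w (fun z : TQ R n => z.2 i 0 : R^o) x = w.2 i 0 :> R.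
Proof.
have [dsnd _] := is_diff_snd x; have [dc _] := is_diff_coord i 0 x.2.
have := derive_comp w dsnd dc.
rewrite (derive_is_diff w (is_diff_snd x)).
by rewrite (derive_is_diff _ (is_diff_coord i 0 x.2)).
Qed.

Lemma derive_phi a x (w : TQ R n) :
  'D_w (phi mu a) x =
  \sum_i ((\sum_j dmu mu j a i x.1 * w.1 j 0) * x.2 i 0
           + mu x.1 a i * w.2 i 0) :> R.
Proof.
rewrite phiE derive_sum; last first.
  move=> i; apply: smooth_derivable; apply: smoothM.
    exact: smooth_mu1.
  exact: smooth_coord2.
apply: eq_bigr => i _; rewrite deriveM; last 2 first.
- exact/smooth_derivable/smooth_mu1.
- exact/smooth_derivable/smooth_coord2.
by rewrite derive_mu1 derive_coord2 addrC [X in X + _]mulrC.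
Qed.

Lemma gradv_phi a x : gradv (phi mu a) x = (row a (mu x.1))^T.
Proof.
have z i : (0 : 'cV[R]_n) i 0 = 0 by rewrite mxE.
(* The direction [(0, delta_mx j 0)] has no q-component, so the terms with derivatives of [mu] drop
   out. *)
have z1 i : \sum_j dmu mu j a i x.1 * (0 : 'cV[R]_n) j 0 = 0.
  by rewrite big1 // => j _; rewrite z mulr0.
apply/colP => j; rewrite !mxE /dv derive_phi /=.
under eq_bigr do rewrite z1 mul0r add0r.
rewrite (bigD1 j) //= big1 => [|i ij]; first by rewrite mxE !eqxx mulr1 addr0.
by rewrite mxE (negbTE ij) mulr0.
Qed.

Variable L : TQ R n -> R^o.

Lemma constrained_fieldE l x : constrained_field L mu l x =
  (x.2, (f L x).2 + minv L x *m ((mu x.1)^T *m l)).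
Proof.
rewrite /constrained_field [X in _ + X]surjective_pairing !raddf_sum /=.
rewrite big1 => [|a _]; last by rewrite scaler0.
congr pair; rewrite /= ?addr0 //; congr (_ + _).
transitivity (minv L x *m \sum_a l a 0 *: (row a (mu x.1))^T).
  by rewrite mulmx_sumr; apply: eq_bigr => a _; rewrite gradv_phi -scalemxAr.
congr (_ *m _); apply/colP => i; rewrite mxE summxE; apply: eq_bigr => a _.
by rewrite !mxE mulrC.
Qed.

Lemma CmxE x : Cmx L mu x = mu x.1 *m (minv L x *m (mu x.1)^T).
Proof.
apply/matrixP => a b; rewrite !mxE; apply: eq_bigr => i _.
by rewrite mxE big_distrr; apply: eq_bigr => j _; rewrite mxE /= mulrA.
Qed.

(** The bracket in the formula for lambda. It collects the derivatives of the [phi mu b] along the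
    unconstrained field [f], as the case l = 0 of [derive_phi_constrained] shows. *)
Definition constraint_drift (x : TQ R n) : 'cV[R]_m :=
  \col_b (\sum_i \sum_j dmu mu j b i x.1 * x.2 i 0 * x.2 j 0
     + \sum_i \sum_j mu x.1 b i * minv L x i j * dq j L x
     - \sum_i \sum_j \sum_k
         mu x.1 b i * minv L x i k * dq j (dv k L) x * x.2 j 0).

Lemma lambdaE x : lambda L mu x = - (invmx (Cmx L mu x) *m constraint_drift x).
Proof.
apply/colP => a; rewrite !mxE; congr (- _); apply: eq_bigr => b _.
by rewrite mxE.
Qed.

(** The multiplier enters the velocity only through (0, m^-1 mu^T l), on which the differential of
    phi gives mu m^-1 mu^T l. *)
Lemma derive_phi_constrained l x b :
  'D_(constrained_field L mu l x) (phi mu b) x =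
  (constraint_drift x + Cmx L mu x *m l) b 0.
Proof.
rewrite constrained_fieldE derive_phi CmxE -!mulmxA /=.
set u := minv L x *m _; rewrite mxE [in RHS]mxE [X in _ = _ + X]mxE.
(* The acceleration part of [f] accounts for the last two sums of the drift; the first comes from
   differentiating [mu] along v. *)
have mu_f : \sum_i mu x.1 b i * (f L x).2 i 0 =
    \sum_i \sum_j mu x.1 b i * minv L x i j * dq j L x
    - \sum_i \sum_j \sum_k
        mu x.1 b i * minv L x i k * dq j (dv k L) x * x.2 j 0 :> R.
  rewrite -sumrB; apply: eq_bigr => i _; rewrite mxE mulrDr mulrN addrC.
  congr (_ - _); rewrite big_distrr; apply: eq_bigr => j _ /=;
    rewrite ?mulrA //.
  by rewrite big_distrr; apply: eq_bigr => k _ /=; rewrite !mulrA.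
rewrite -[X in _ = X + _]addrA -mu_f -addrA -!big_split.
apply: eq_bigr => i _ /=.
rewrite [in LHS]mxE mulrDr big_distrl /=; congr (_ + _).
by apply: eq_bigr => j _; rewrite mulrAC.
Qed.

End Constraints.

(** * A globally smooth retraction onto the constraint set, up to a scalar factor *)

Section Retraction.
Variables (R : realType) (n m : nat).
Variables (mu : Qsp R n -> 'M[R]_(m, n)) (B : 'M[R]_(n, m)).
Hypothesis mu_smooth : smooth mu.

Definition retr_det (q : 'cV[R]_n) : R^o := \det (mu q *m B).
Definition retr_corr (q : 'cV[R]_n) : 'M[R]_(n, m) := B *m \adj (mu q *m B).
(** Where G = mu B is invertible, this is det G times the projection of v onto the kernel of mu
    along the image of B. *)
Definition retr_vec (z : TQ R n) : 'cV[R]_n :=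
  retr_det z.1 *: z.2 - retr_corr z.1 *m (mu z.1 *m z.2).

Lemma mul_retr_vec z : mu z.1 *m retr_vec z = 0.
Proof.
rewrite /retr_vec /retr_corr mulmxBr -scalemxAr !mulmxA mul_mx_adj mul_scalar_mx.
by rewrite -scalemxAl subrr.
Qed.

Lemma D_mulmx z : D mu z <-> mu z.1 *m z.2 = 0.
Proof.
split=> [Dz|muz a].
  by apply/colP => a; rewrite mxE [RHS]mxE; exact: Dz.
by have /colP/(_ a) := muz; rewrite mxE [RHS]mxE.
Qed.

Lemma smooth_mulB a b : smooth (fun q => (mu q *m B) a b : R^o).
Proof.
rewrite (_ : (fun _ => _) = \sum_j B j b *: (fun q => mu q a j : R^o)).
  by apply: smooth_sum => j; apply: smoothZ; exact: smooth_mu_entry.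
apply/funext => q; rewrite fct_sumE mxE; apply: eq_bigr => j _.
by rewrite mulrC.
Qed.

Lemma smooth_retr_det : smooth retr_det.
Proof. exact/smooth_det/smooth_mulB. Qed.

Lemma smooth_retr_corr i a : smooth (fun q => retr_corr q i a : R^o).
Proof.
rewrite (_ : (fun _ => _) =
    \sum_b B i b *: (fun q => (\adj (mu q *m B)) b a : R^o)).
  by apply: smooth_sum => b; apply: smoothZ; exact/smooth_adj/smooth_mulB.
by apply/funext => q; rewrite fct_sumE mxE.
Qed.

(** Each summand of the correction shows a factor [phi mu a], which vanishes on [D]. *)
Lemma retr_vecE i :
  (fun z => retr_vec z i 0 : R^o) =
  (fun z : TQ R n => retr_det z.1) * (fun z : TQ R n => z.2 i 0 : R^o) +
  (- 1 : R) *: \sum_a (fun z : TQ R n => retr_corr z.1 i a : R^o) * phi mu a.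
Proof.
apply/funext => z; rewrite fctE /retr_vec !mxE; congr (_ + _).
rewrite fctE scaleN1r fct_sumE; congr (- _); apply: eq_bigr => a _.
by rewrite [X in _ * X]mxE.
Qed.

Lemma smooth_retr_vec : smooth retr_vec.
Proof.
apply: smooth_mx => i j; rewrite ord1 retr_vecE; apply: smoothD.
  by apply: smoothM; [exact/smooth_fst/smooth_retr_det | exact: smooth_coord2].
apply: smoothZ; apply: smooth_sum => a.
apply: smoothM; last exact: smooth_phi.
exact: (smooth_fst _ (smooth_retr_corr i a)).
Qed.

(** By the Leibniz rule, the derivatives of [retr_corr] appear multiplied by [phi mu a x], which is
    0 on [D]; only the derivatives of the determinant and of phi survive. *)
Lemma derive_retr_vec (x w : TQ R n) : D mu x ->
  'D_w retr_vec x = 'D_(w.1) retr_det x.1 *: x.2 + retr_det x.1 *: w.2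
                - retr_corr x.1 *m \col_a 'D_w (phi mu a) x.
Proof.
move=> Dx.
rewrite derive_mx; last exact/smooth_derivable/smooth_retr_vec.
apply/colP => i; rewrite mxE retr_vecE.
have s1 : smooth (fun z : TQ R n => retr_det z.1) by exact/smooth_fst/smooth_retr_det.
have s2 : smooth (fun z : TQ R n => z.2 i 0 : R^o) by exact: smooth_coord2.
have s3 a : smooth (fun z : TQ R n => retr_corr z.1 i a : R^o).
  exact: (smooth_fst _ (smooth_retr_corr i a)).
have s4 a := smooth_phi mu_smooth a.
rewrite deriveD; last 2 first.
- by apply/smooth_derivable/smoothM.
- by apply/smooth_derivable/smoothZ/smooth_sum => a; exact: smoothM.
rewrite deriveM; try exact: smooth_derivable.
rewrite deriveZ; last by apply/smooth_derivable/smooth_sum => a; exact: smoothM.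
rewrite derive_sum; last by move=> a; apply/smooth_derivable/smoothM.
rewrite derive_coord2 derive_fst; last exact/smooth_differentiable/smooth_retr_det.
rewrite scaleN1r !mxE [X in X - _]addrC [_ *: 'D__ _ _]mulrC.
congr (_ + _ - _); apply: eq_bigr => a _.
rewrite [X in _ = _ * X]mxE deriveM; try exact: smooth_derivable.
by rewrite Dx scale0r addr0.
Qed.

End Retraction.

(** * Vectors annihilated by the constraint differentials are tangent *)

Section Tangent.
Variables (R : realType) (n m : nat).
Variables (mu : Qsp R n -> 'M[R]_(m, n)).
Hypothesis mu_smooth : smooth mu.

Lemma tangent_D (B : 'M[R]_(n, m)) (x w : TQ R n) :
  mu x.1 *m B \in unitmx -> D mu x ->
  (forall a, 'D_w (phi mu a) x = 0) -> tangent (D mu) x w.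
Proof.
move=> unitB Dx phiw; set d := retr_det mu B x.1.
have d0 : d != 0 by rewrite -unitfE -unitmxE.
(* The correction cancels the derivative of the factor [det (G q)] along [w]. *)
pose w' : TQ R n := (w.1, w.2 - (d^-1 * 'D_(w.1) (retr_det mu B) x.1) *: x.2).
pose line (t : R^o) : TQ R n := x + t *: w'.
(* The divisor is the constant [d], the determinant at [x], so [Psi] is smooth everywhere and still
   fixes [x]. *)
pose Psi (z : TQ R n) : TQ R n := (z.1, d^-1 *: retr_vec mu B z).
have dline t : is_diff t line (fun s : R^o => s *: w') by exact: is_diff_line.
have sPsi : smooth Psi.
  apply: smooth_pair; last exact/smoothZ/smooth_retr_vec.
  exact: (smooth_lin (@is_diff_fst _ _ _)).
have line0 : line 0 = x by rewrite /line scale0r addr0.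
(* [w'] differs from [w] by a multiple of [(0, x.2)]. As phi is linear in v, its derivative in that
   direction is phi(x) = 0. *)
have phiw' a : 'D_w' (phi mu a) x = 0.
  rewrite derive_phi //; transitivity
      ('D_w (phi mu a) x - d^-1 * 'D_(w.1) (retr_det mu B) x.1 * phi mu a x : R).
    rewrite derive_phi // mulr_sumr -sumrB; apply: eq_bigr => i _ /=.
    rewrite [X in _ + _ * X]mxE [X in _ + X]mulrDr addrA mxE.
    by rewrite [X in _ * - X]mxE mulrN mulrCA.
  by rewrite phiw Dx mulr0 subr0.
have Psi_der : 'D_w' Psi x = w.
  rewrite derive_pair; last 2 first.
  - by have [] := is_diff_fst x.
  - exact/smooth_differentiable/smoothZ/smooth_retr_vec.
  rewrite (derive_is_diff _ (is_diff_fst x)) deriveZ; last first.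
    exact/smooth_derivable/smooth_retr_vec.
  rewrite derive_retr_vec // -/d (_ : \col_a _ = 0).
    rewrite mulmx0 subr0 /= scalerBr scalerA mulrA divff // mul1r addrC subrK.
    by rewrite scalerK //; case: (w).
  by apply/colP => a; rewrite mxE phiw' mxE.
(* Any positive radius would do, since [line] and [Psi] are globally defined. *)
exists 1, (Psi \o line); split.
- by [].
- move=> k; apply: (Ck_sub (B := setT)) => //.
  exact: (smooth_comp_affine dline sPsi).
- move=> t _; apply/D_mulmx; rewrite /Psi /= -scalemxAr mul_retr_vec scaler0 //.
(* At a point of [D] the correction vanishes, so [retr_vec] only scales the velocity by [d]. *)
- rewrite /= line0 /Psi (_ : retr_vec mu B x = d *: x.2) ?scalerK //.
    by case: (x).
  have /D_mulmx Dx' := Dx.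
  by rewrite /retr_vec Dx' mulmx0 subr0.
- have [dl0 _] := dline 0.
  have dPsi := smooth_differentiable (line 0) sPsi.
  split; first exact/derivable1_diffP/(differentiable_comp dl0 dPsi).
  have := derive_comp (1 : R^o) dl0 dPsi.
  by rewrite (derive_is_diff _ (dline 0)) scale1r line0 Psi_der.
Qed.

End Tangent.

(** * The multiplier as the unique solution of a linear system *)

Section Main.
Variables (R : realType) (n m : nat).
Variables (L : TQ R n -> R^o) (mu : Qsp R n -> 'M[R]_(m, n)).
Hypothesis mu_smooth : smooth mu.

Lemma Cmx_unit x : mass L x \in unitmx -> posdefmx (mass L x) ->
  row_free (mu x.1) -> Cmx L mu x \in unitmx.
Proof.
move=> Mu Mpos mufree; rewrite CmxE mulmxA.
by apply: posdefmx_congr_unit => //; exact: posdefmx_inv.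
Qed.

(** One implication gives the tangency of [h]; the other identifies the multiplier of a solution of
    the DAE. *)
Lemma lambda_unique x l : Cmx L mu x \in unitmx ->
  (forall a, 'D_(constrained_field L mu l x) (phi mu a) x = 0) <->
  l = lambda L mu x.
Proof.
move=> Cu; split=> [phi0|-> a].
  have : constraint_drift mu L x + Cmx L mu x *m l = 0.
    by apply/colP => a; rewrite -derive_phi_constrained // phi0 mxE.
  move/eqP; rewrite addrC addr_eq0 => /eqP Cl.
  by rewrite lambdaE -mulmxN -Cl mulKmx.
by rewrite derive_phi_constrained // lambdaE mulmxN mulKVmx // subrr mxE.
Qed.

End Main.

Theorem proposition2p1 (R : realType) (n m : nat) (hmn : (m <= n)%N)
  (L : TQ R n -> R^o) (mu : Qsp R n -> 'M[R]_(m, n))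
  (L_smooth : smooth L)
  (mu_smooth : smooth mu)
  (mass_q : forall (q v w : Qsp R n), mass L (q, v) = mass L (q, w))
  (mass_reg : forall x : TQ R n, mass L x \in unitmx)
  (mass_pos : forall x : TQ R n, posdefmx (mass L x))
  (mu_free : forall q : Qsp R n, row_free (mu q)) :
  (forall x : TQ R n, D mu x -> tangent (D mu) x (h L mu x)) /\
  (forall (I : set R) (y : R^o -> TQ R n) (l : R -> 'cV[R]_m),
     open I -> is_interval I ->
     DAE_solution L mu I y l <->
     (forall t : R, I t ->
        [/\ D mu (y t),
            is_derive (t : R^o) 1 y (h L mu (y t))
          & l t = lambda L mu (y t)])).
Proof.
have Cu x : Cmx L mu x \in unitmx by exact: Cmx_unit.
split=> [x Dx|I y l openI _].
  (* This choice of [B] makes [mu x.1 *m B] the invertible matrix [Cmx L mu x]. *)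
  apply: (tangent_D mu_smooth (B := minv L x *m (mu x.1)^T)) => //.
    by rewrite -CmxE.
  exact/(lambda_unique mu_smooth _ (Cu x)).
(* From the ODE to the DAE it suffices to substitute the multiplier, since [h] is the constrained
   field at [lambda]. *)
split=> sol t It; last first.
  have [Dy y_der lE] := sol t It; split; last exact: Dy.
  by rewrite lE.
have [y_der Dy] := sol t It.
suff lE : l t = lambda L mu (y t) by split=> //; rewrite /h -lE.
apply/(lambda_unique mu_smooth _ (Cu _)) => a.
have dphi := smooth_differentiable (y t) (smooth_phi mu_smooth a).
have [_ <-] := is_derive_comp1 y_der dphi.
(* The composite of phi with [y] is known to vanish only on [I]. As [I] is open, it agrees with the
   zero function near [t], so its derivative there is 0. *)
rewrite -[RHS](derive_cst (0 : R^o) (t : R^o) 1); apply: near_eq_derive.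
near=> s; apply: (sol s _).2; near: s; exact: open_nbhs_nbhs.
Unshelve. all: by end_near. Qed.
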